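(* For any constant $\alpha \geq 1$, there is a multigraph $G$ with maximum degree $\Delta$, no cycles of length $3$ or $4$, an assignment of lists each with size $\ell=\alpha\sqrt{\Delta/\ln\Delta}$, an edge labelling $\tau$ with conflict degree $D(\tau) = \ell^{f(\alpha)}$, and such that $G$ does not have a proper conflict colouring from these lists, where $f(\alpha) = 1 - 2^{-\lfloor \log_{\sqrt{2}}\alpha\rfloor - 1}$ is non-negative for $\alpha \geq 1$, non-decreasing, and tending to $1$ as $\alpha$ approaches infinity. In particular, when $\alpha = 2\sqrt{2} + o(1)$ we have $f(\alpha) = \frac{15}{16}$.
   Context: Multigraphs may have parallel edges (cycles of length 2 are permitted), and parallel edges are counted with multiplicity in degrees. Each vertex $v$ of a multigraph $G=(V,E)$ is assigned a list $L(v)\subset\mathbb{N}$ of candidate colours. An edge labelling is a map $\tau:E\to\mathbb{N}\times\mathbb{N}$ assigning to each edge an ordered pair of colours. For an edge $e=uv$, writing $\tau(e)=(c,c')$ means that $c$ is the colour corresponding to $u$ and $c'$ the colour corresponding to $v$ (written as $e=vu$, the pair is ordered the opposite way); the label forbids $u$ from receiving $c$ and $v$ from receiving $c'$ simultaneously. A proper conflict colouring of $G$ from the lists is a vertex colouring $\sigma$ with $\sigma(v)\in L(v)$ for every $v\in V$ such that there is no edge $e=uv$ with $\tau(e)=(\sigma(u),\sigma(v))$. For a colour $c$ and a pair of vertices $u$ and $v$, let $d(\tau,c,u,v)$ be the number of edges $e=uv$ of $G$ such that $\tau(e)=(c,c')$ for some colour $c'$. The conflict degree $D(\tau)$ is the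 maximum of $d(\tau,c,u,v)$ over all colours $c$ and pairs $u,v$.
   Formalization: The list size is α√(Δ/ln Δ) rounded up to an integer (exact equality is impossible e.g. for α = 1), with Δ arbitrarily large; and in α = 2√2 + o(1) the o(1) term is taken nonnegative, since just below 2√2 one has f = 7/8. *)

(* Defs.v *)
From HB Require Import structures.
From mathcomp Require Import all_boot all_order all_algebra finmap.
From mathcomp Require Import all_classical all_reals all_analysis.
Set Implicit Arguments.
Unset Strict Implicit.
Unset Printing Implicit Defensive.
Import Order.TTheory GRing.Theory Num.Theory.
Local Open Scope ring_scope.

(* Finite loopless multigraphs.  The order of the two ends of an edge is only
   a reference orientation, used below to read edge labels. *)
Record multigraph := Multigraph {
  vertex : finType;
  edge : finType;
  ends : edge -> vertex * vertex;
  ends_neq : forall e, (ends e).1 != (ends e).2 }.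

Section Multigraph.
Variable G : multigraph.
Implicit Types (u v : vertex G) (e : edge G) (c : nat).

Definition degree v : nat :=
  #|[set e : edge G | ((ends e).1 == v) || ((ends e).2 == v)]%SET|.

Definition max_degree : nat := \max_(v : vertex G) degree v.

Definition adjacent : rel (vertex G) :=
  fun u v => [exists e : edge G, (ends e == (u, v)) || (ends e == (v, u))].

(* For k > 2, the k-cycles of G are the repetition-free cyclic sequences of k
   vertices along the adjacency relation, up to the choice of parallel edges. *)
Definition has_cycle_of_length (k : nat) : Prop :=
  exists s : seq (vertex G), size s = k /\ ucycle adjacent s.

Definition edge_labelling := edge G -> nat * nat.

(* The pair tau(e) when e is written e = uv (first colour for u, second colour
   for v); None if u and v are not the ends of e. *)
Definition label_at (tau : edge_labelling) e u v : option (nat * nat) :=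
  if ends e == (u, v) then Some (tau e)
  else if ends e == (v, u) then Some ((tau e).2, (tau e).1)
  else None.

Definition conflict_count (tau : edge_labelling) c u v : nat :=
  #|[set e : edge G | omap fst (label_at tau e u v) == Some c]%SET|.

(* D is the maximum of conflict_count; c ranges over all of nat. *)
Definition is_conflict_degree (tau : edge_labelling) (D : nat) : Prop :=
  (forall c u v, (conflict_count tau c u v <= D)%N) /\
  (exists c u v, conflict_count tau c u v = D).

Definition proper_conflict_colouring (L : vertex G -> {fset nat})
    (tau : edge_labelling) (sigma : vertex G -> nat) : Prop :=
  (forall v, sigma v \in L v) /\
  (forall e u v, label_at tau e u v <> Some (sigma u, sigma v)).

End Multigraph.

Section Exponent.
Variable R : realType.

Definition logb (b x : R) : R := ln x / ln b.

Definition f (alpha : R) : R :=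
  1 - 2 ^ (- Num.floor (logb (Num.sqrt 2) alpha) - 1).

End Exponent.

(* Main.v *)
Require Import Defs.
From HB Require Import structures.
From mathcomp Require Import all_boot all_order all_algebra finmap.
From mathcomp Require Import all_classical all_reals all_analysis.
From mathcomp Require Import ring lra.
Set Implicit Arguments.
Unset Strict Implicit.
Unset Printing Implicit Defensive.
Import Order.TTheory GRing.Theory Num.Theory.
Import numFieldNormedType.Exports.
Local Open Scope classical_set_scope.
Local Open Scope ring_scope.

(** Write k = floor(log_{sqrt 2} alpha) + 1, so that alpha^2 < 2^k, take
    l = m^(2^k) for a large integer m and D = m^(2^k - 1), and cut every list
    into m blocks of D colours.  Over a simple d-regular bipartite graph without
    4-cycles, replace each edge by D^2 parallel edges forbidding all pairs of
    colours from one block at one end and one block at the other: the conflict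
    degree is D, and a proper colouring induces a choice of blocks avoiding a
    single pair of blocks on each simple edge.  With n vertices, hence nd/2
    simple edges, some assignment of pairs of blocks defeats all m^n choices as
    soon as m^n (1 - 1/m^2)^(nd/2) < 1, which follows from d > 2 m^2 ln m.
    Taking d about Delta/D^2 with l about alpha sqrt(Delta/ln Delta), one has
    d >= (2^k/alpha^2) 2 m^2 ln m up to an additive constant, whence the
    condition alpha^2 < 2^k. *)

(** * Counting assignments of pairs of blocks *)

(** Union bound: a fixed [s] is avoided by exactly (m^2 - 1)^|E| of the m^(2|E|) assignments, so the
    m^|V| sets [good s] cannot cover them all, and any [T] outside their union meets every [s]. *)
Lemma exists_uncolourable_labelling (V E : finType) (src tgt : E -> V) (m : nat) :
  (m ^ #|V| * (m * m).-1 ^ #|E| < (m * m) ^ #|E|)%N ->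
  exists T : {ffun E -> 'I_m * 'I_m},
    forall s : V -> 'I_m, exists e, T e = (s (src e), s (tgt e)).
Proof.
move=> hlt.
pose good (s : {ffun V -> 'I_m}) : {set {ffun E -> 'I_m * 'I_m}} :=
  [set T : {ffun E -> 'I_m * 'I_m} |
    [forall e, T e != (s (src e), s (tgt e))]]%SET.
have card_good s : #|good s| = ((m * m).-1 ^ #|E|)%N.
  have -> : #|good s| =
      #|family (fun e => predC1 (s (src e), s (tgt e)) : pred ('I_m * 'I_m))|.
    by apply: eq_card => T; rewrite !inE.
  rewrite card_family foldrE big_image /=.
  rewrite (eq_bigr (fun _ => (m * m).-1)); first by rewrite prod_nat_const.
  by move=> e _; rewrite cardC1 card_prod card_ord.
have [|] := boolP [exists T, T \notin (\bigcup_s good s)%SET].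
  move=> /existsP[T Tbad]; exists T => s.
  have : T \notin good [ffun v => s v].
    by apply: contra Tbad => h; apply/bigcupP; exists [ffun v => s v].
  rewrite inE negb_forall => /existsP[e /negPn/eqP eE]; exists e.
  by rewrite eE !ffunE.
rewrite negb_exists => /forallP allgood; exfalso.
move: hlt; rewrite ltnNge => /negP; apply.
have -> : ((m * m) ^ #|E| = #|[set: {ffun E -> 'I_m * 'I_m}]%SET|)%N.
  by rewrite cardsT card_ffun card_prod card_ord.
apply: (@leq_trans #|(\bigcup_s good s)%SET|).
  by apply/subset_leq_card/fintype.subsetP => T _; have := allgood T; rewrite negbK.
have union_bound : (#|(\bigcup_s good s)%SET| <= \sum_s #|good s|)%N.
  apply: (big_ind2 (fun (A : {set _}) n => #|A| <= n)%N); first by rewrite cards0.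
    by move=> A1 n1 A2 n2 h1 h2; rewrite (leq_trans (leq_card_setU _ _)) ?leq_add.
  by [].
apply: (leq_trans union_bound).
rewrite (eq_bigr (fun _ => ((m * m).-1 ^ #|E|)%N)); last by move=> s _.
by rewrite sum_nat_const card_ffun card_ord.
Qed.

(** * Replacing each simple edge by D^2 parallel edges *)

Section Blowup.
Variables (P Q I : finType) (src : I -> P) (tgt : I -> Q).
Variables D N : nat.

Let V : finType := ((P + 'I_N) + (Q + unit))%type.
Let E : finType := (I * ('I_D * 'I_D) + 'I_N)%type.

Definition blowup_ends (e : E) : V * V :=
  match e with
  | inl (i, _) => (inl (inl (src i)), inr (inl (tgt i)))
  | inr j => (inl (inr j), inr (inr tt))
  end.

Lemma blowup_ends_neq e : (blowup_ends e).1 != (blowup_ends e).2.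
Proof. by case: e => [[]|]. Qed.

(* The disjoint star with [N] leaves only serves to make the maximum degree [N]. *)
Definition blowup : multigraph := Multigraph blowup_ends_neq.

Definition incident (x : P + 'I_N) (y : Q + unit) : Prop :=
  match x, y with
  | inl u, inl w => exists i, src i = u /\ tgt i = w
  | inr _, inr _ => True
  | _, _ => False
  end.

Lemma blowup_adjacent_incident (u v : V) : @Defs.adjacent blowup u v ->
  match u, v with
  | inl x, inr y | inr y, inl x => incident x y
  | _, _ => False
  end.
Proof.
case/existsP => -[[i ?]|j] /orP[] /eqP[<- <-] //=; by exists i.
Qed.

Lemma blowup_no_triangle : ~ has_cycle_of_length blowup 3.
Proof.
case=> s [+ +]; case: s => [|a [|b [|c [|? ?]]]] // _ /andP[/and4P[ab bc ca _] _].
move: (blowup_adjacent_incident ab) (blowup_adjacent_incident bc)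
  (blowup_adjacent_incident ca).
by case: (a) (b) (c) => ? [] ? [] ?.
Qed.

(** A 4-cycle is encoded by its edges: [i1], [i2] share an end in [P], as do [i3], [i4], while [i1],
    [i3] share an end in [Q], as do [i2], [i4]. *)
Hypothesis no_quadrangle : forall i1 i2 i3 i4,
  src i1 = src i2 -> src i3 = src i4 -> tgt i1 = tgt i3 -> tgt i2 = tgt i4 ->
  src i1 = src i3 \/ tgt i1 = tgt i2.

Lemma incident_no_quadrangle x1 x2 y1 y2 : incident x1 y1 -> incident x2 y1 ->
  incident x1 y2 -> incident x2 y2 -> x1 = x2 \/ y1 = y2.
Proof.
case: x1 x2 y1 y2 => [u1|j1] [u2|j2] [w1|[]] [w2|[]] //=; try by right.
move=> [i1 [s1 t1]] [i3 [s3 t3]] [i2 [s2 t2]] [i4 [s4 t4]]; subst.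
by have [->|->] := @no_quadrangle i1 i2 i3 i4 (esym s2) (esym s4) (esym t3) (esym t4);
  [left|right].
Qed.

Lemma blowup_no_quadrangle : ~ has_cycle_of_length blowup 4.
Proof.
case=> s [+ +]; case: s => [|a [|b [|c [|d [|? ?]]]]] // _ /andP[/and5P[ab bc cd da _]].
rewrite /= !inE !negb_or => /and4P[/and3P[_ ac _] /andP[_ bd] _ _].
have {}ac : a <> c by apply/eqP.
have {}bd : b <> d by apply/eqP.
move: (blowup_adjacent_incident ab) (blowup_adjacent_incident bc)
  (blowup_adjacent_incident cd) (blowup_adjacent_incident da).
case: a ac {ab da} => x1 ac; case: c ac {bc cd} => // x2 ac;
case: b bd => // y1 bd; case: d bd => // y2 bd i1 i2 i3 i4.
- by case: (incident_no_quadrangle i1 i2 i4 i3) => h; [apply: ac|apply: bd]; rewrite h.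
- by case: (incident_no_quadrangle i1 i4 i2 i3) => h; [apply: bd|apply: ac]; rewrite h.
Qed.

Hypothesis flag_inj : forall i j, src i = src j -> tgt i = tgt j -> i = j.
Variables (m : nat) (T : I -> 'I_m * 'I_m).

(** Block [j] consists of the [D] colours starting at [j * D]; the copies [(a, b)] of [i] run
    through all pairs of colours from the two blocks of [T i]. *)
Definition blowup_labelling : edge_labelling blowup := fun e =>
  match (e : E) with
  | inl (i, (a, b)) => ((T i).1 * D + a, (T i).2 * D + b)%N
  | inr _ => (0, 0)%N
  end.

(** By [flag_inj], the copied edges between [u] and [v] all come from one [i]. The colour [c] fixes
    the offset at [u], so the offset at [v] determines the copy. *)
Lemma blowup_conflict_count_le c u v : (0 < D)%N ->
  (conflict_count blowup_labelling c u v <= D)%N.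
Proof.
move=> D0; rewrite -[leqRHS]card_ord.
pose other_end (e : E) : 'I_D := match e, u with
  | inl (_, (_, b)), inl _ => b
  | inl (_, (a, _)), inr _ => a
  (* A constant keeps injectivity, as a leaf and the centre of the star are joined by one edge
     only. *)
  | inr _, _ => Ordinal D0 end.
apply: (@leq_card_in _ _ other_end) => e1 e2; rewrite !inE.
have labelE e : omap fst (label_at blowup_labelling e u v) = Some c ->
    (blowup_ends e = (u, v) /\ (blowup_labelling e).1 = c) \/
    (blowup_ends e = (v, u) /\ (blowup_labelling e).2 = c).
  rewrite /label_at; case: eqP => [h [<-]|_]; first by left.
  by case: eqP => [h [<-]|_] //; right.
move=> /eqP/labelE h1 /eqP/labelE h2.
case: e1 e2 h1 h2 => [[i1 [a1 b1]]|j1] [[i2 [a2 b2]]|j2] /=; rewrite /other_end.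
- case=> -[[<- <-] <-] [] [] [] // => [s12 t12 /eqP|s12 t12 /eqP];
    have i12 := flag_inj (esym s12) (esym t12); rewrite -i12 eqn_add2l => /eqP/val_inj ->.
    by move=> ->.
  by move=> ->.
- by case=> -[[<- <-] _] [] [].
- by case=> -[[<- <-] _] [] [].
- by case=> -[[<- <-] _] [] [] // [->].
Qed.

Lemma blowup_conflict_degree (i : I) : (0 < D)%N ->
  is_conflict_degree blowup_labelling D.
Proof.
move=> D0; split=> [c u v|]; first exact: blowup_conflict_count_le.
(* The bound is attained by the first colour of the block of [i] at [src i], through the [D] copies
   [(0, b)]. *)
exists ((T i).1 * D + Ordinal D0)%N, (inl (inl (src i))), (inr (inl (tgt i))).
apply/eqP; rewrite eqn_leq blowup_conflict_count_le //=.
pose edge_of (b : 'I_D) : E := inl (i, (Ordinal D0, b)).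
have edge_of_inj : injective edge_of by move=> b b' [].
rewrite -[leqLHS]card_ord -cardsT -(card_imset _ edge_of_inj).
apply/subset_leq_card/fintype.subsetP => e /imsetP[b _ ->].
by rewrite inE /label_at /= eqxx.
Qed.

(** The star centre has degree exactly [N], its leaves have degree 1, and elsewhere a degree is
    [D * D] times a simple degree. *)
Lemma blowup_max_degree :
  (forall p, #|[set i | src i == p]%SET| * (D * D) <= N)%N ->
  (forall q, #|[set i | tgt i == q]%SET| * (D * D) <= N)%N ->
  (0 < N)%N -> max_degree blowup = N.
Proof.
move=> degP degQ N0.
have card_main (A : {set I}) :
    #|[set (inl z : E) | z in finset.setX A [set: 'I_D * 'I_D]%SET]%SET| = (#|A| * (D * D))%N.
  by rewrite card_imset; [rewrite cardsX cardsT card_prod card_ord|move=> ? ? []].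
have degree_center : @degree blowup (inr (inr tt)) = N.
  rewrite -[RHS]card_ord -cardsT -(card_imset _ (inr_inj : injective (inr : _ -> E))).
  apply: eq_card => e; rewrite inE; apply/idP/imsetP; last by case=> j _ ->.
  by case: e => [[i ab]|j] // _; exists j.
apply/eqP; rewrite eqn_leq; apply/andP; split; last first.
  by rewrite -[leqLHS]degree_center /max_degree; apply: leq_bigmax.
apply/bigmax_leqP => -[[p|j]|[q|[]]] _.
- apply: leq_trans (degP p); rewrite -card_main.
  apply/subset_leq_card/fintype.subsetP => -[[i ab]|j]; rewrite inE //= orbF => ip.
  by apply/imsetP; exists (i, ab); rewrite // !inE andbT; exact: ip.
- apply: leq_trans N0; rewrite -(cards1 (inr j : E)).
  apply/subset_leq_card/fintype.subsetP => -[[i ab]|j']; rewrite !inE //= orbF => /eqP[->].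
  by [].
- apply: leq_trans (degQ q); rewrite -card_main.
  apply/subset_leq_card/fintype.subsetP => -[[i ab]|j]; rewrite inE //= => iq.
  by apply/imsetP; exists (i, ab); rewrite // !inE andbT; exact: iq.
- by rewrite degree_center.
Qed.

Lemma blowup_uncolourable (L : vertex blowup -> {fset nat}) :
  (forall v c, c \in L v -> (c < m * D)%N) ->
  (forall s : P + Q -> 'I_m, exists i, T i = (s (inl (src i)), s (inr (tgt i)))) ->
  ~ exists sigma, proper_conflict_colouring L blowup_labelling sigma.
Proof.
move=> L_lt bad [sigma [sigmaL sigma_proper]].
have sigma_lt v : (sigma v < m * D)%N.
  exact: L_lt (sigmaL v).
have block_lt v : (sigma v %/ D < m)%N.
  by have := sigma_lt v; case: (posnP D) => [->|D0]; rewrite ?muln0 // ltn_divLR.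
pose s (z : P + Q) : 'I_m := match z with
  | inl u => Ordinal (block_lt (inl (inl u)))
  | inr w => Ordinal (block_lt (inr (inl w))) end.
have [i Ti] := bad s.
have rem_lt v : (sigma v %% D < D)%N.
  by rewrite ltn_mod; case: (posnP D) (sigma_lt v) => // ->; rewrite muln0.
(* The quotients by [D] at the ends of [i] are the blocks of [T i]; the remainders select the copy
   of [i] that forbids exactly the two colours used. *)
apply: (sigma_proper (inl (i, (Ordinal (rem_lt (inl (inl (src i)))),
   Ordinal (rem_lt (inr (inl (tgt i))))))) (inl (inl (src i))) (inr (inl (tgt i)))).
by rewrite /label_at /= eqxx Ti /= -!divn_eq.
Qed.

End Blowup.

(** * A regular incidence graph without 4-cycles *)

Section AffineFlags.
Variables (d p : nat).
Hypotheses (p_prime : prime p) (d_le_p : (d <= p)%N).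

Let flag : finType := ('I_d * 'I_d * 'F_p)%type.

(* The line of slope [a] and intercept [b], at its point of abscissa [x]:
   bounding slopes and abscissas by [d] leaves a [d]-regular incidence graph. *)
Definition flag_point (t : flag) : 'I_d * 'F_p :=
  let: (x, a, b) := t in (x, a%:R * x%:R + b).
Definition flag_line (t : flag) : 'I_d * 'F_p := let: (x, a, b) := t in (a, b).

Lemma natF_inj (i j : 'I_d) : (i%:R : 'F_p) = j%:R -> i = j.
Proof.
move=> /(congr1 val) /=; rewrite !val_Fp_nat // !modn_small; first exact: val_inj.
  exact: leq_trans (ltn_ord j) d_le_p.
exact: leq_trans (ltn_ord i) d_le_p.
Qed.

Lemma flag_point_line_inj i j :
  flag_point i = flag_point j -> flag_line i = flag_line j -> i = j.
Proof. by case: i j => [[x a] b] [[x' a'] b'] [-> _] [-> ->]. Qed.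

(** Comparing two lines at two common points gives (a - a')(x - x') = 0 in the field F_p. Equal
    slopes force equal intercepts, and equal abscissas force equal points on a common line. *)
Lemma flag_no_quadrangle i1 i2 i3 i4 :
  flag_point i1 = flag_point i2 -> flag_point i3 = flag_point i4 ->
  flag_line i1 = flag_line i3 -> flag_line i2 = flag_line i4 ->
  flag_point i1 = flag_point i3 \/ flag_line i1 = flag_line i2.
Proof.
case: i1 i2 i3 i4 => [[x1 a1] b1] [[x2 a2] b2] [[x3 a3] b3] [[x4 a4] b4].
move=> /eqP + /eqP; rewrite !xpair_eqE => /andP[/eqP ? e1] /andP[/eqP ? e2].
move=> /= [? ?] [? ?]; subst.
have : (a3%:R - a4%:R) * (x2%:R - x4%:R) == 0 :> 'F_p.
  move: e1 e2; rewrite -subr_eq0 => /eqP e1; rewrite -subr_eq0 => /eqP e2.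
  apply/eqP; transitivity ((a3%:R * x2%:R + b3 - (a4%:R * x2%:R + b4))
    - (a3%:R * x4%:R + b3 - (a4%:R * x4%:R + b4)) : 'F_p); first by ring.
  by rewrite e1 e2 subrr.
rewrite mulf_eq0 !subr_eq0 => /orP[/eqP/natF_inj a34|/eqP/natF_inj x24].
  by right; move: e1; rewrite /flag_line a34 => /eqP/addrI ->.
by left; rewrite x24.
Qed.

Lemma card_flag_point u : (#|[set i | flag_point i == u]%SET| <= d)%N.
Proof.
rewrite -[leqRHS]card_ord.
apply: (@leq_card_in _ _ (fun t : flag => t.1.2)) => -[[x a] b] [[x' a'] b'].
rewrite !inE => /eqP <-; rewrite xpair_eqE => /andP[/eqP -> +] /= aa.
by rewrite aa => /eqP/addrI ->.
Qed.

Lemma card_flag_line u : (#|[set i | flag_line i == u]%SET| <= d)%N.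
Proof.
rewrite -[leqRHS]card_ord.
apply: (@leq_card_in _ _ (fun t : flag => t.1.1)) => -[[x a] b] [[x' a'] b'].
by rewrite !inE => /eqP <- /eqP [-> ->] /= ->.
Qed.

End AffineFlags.

(** * Assembling the multigraph *)

(** For a prime p > d the incidence graph has 2dp vertices and d^2 p edges, so the inequality
    required for counting is the dp-th power of the last hypothesis, which is free of p. *)
Lemma exists_uncolourable_multigraph (m D d N : nat) :
  (0 < D)%N -> (0 < d)%N -> (d * (D * D) <= N)%N ->
  (m ^ 2 * (m * m).-1 ^ d < (m * m) ^ d)%N ->
  exists (G : multigraph) (L : vertex G -> {fset nat}) (tau : edge_labelling G),
    [/\ max_degree G = N,
        ~ has_cycle_of_length G 3 /\ ~ has_cycle_of_length G 4,
        forall v, #|` L v|%fset = (m * D)%N,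
        is_conflict_degree tau D
      & ~ exists sigma, proper_conflict_colouring L tau sigma].
Proof.
move=> D0 d0 dDN m_d.
have [p d_lt_p p_prime] := prime_above d; have d_le_p := ltnW d_lt_p.
have p0 : (0 < p)%N by apply: prime_gt0.
have cardF : #|'F_p| = p by rewrite card_Fp.
pose src (t : 'I_d * 'I_d * 'F_p) : ('I_d * 'F_p) + ('I_d * 'F_p) := inl (flag_point t).
pose tgt (t : 'I_d * 'I_d * 'F_p) : ('I_d * 'F_p) + ('I_d * 'F_p) := inr (flag_line t).
have [|T badT] := @exists_uncolourable_labelling _ _ src tgt m.
  rewrite card_sum !card_prod cardF !card_ord.
  rewrite (_ : (d * p + d * p = 2 * (d * p))%N); last by rewrite mul2n addnn.
  rewrite (_ : (d * d * p = d * (d * p))%N); last by rewrite mulnA.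
  have : (0 < d * p)%N by rewrite muln_gt0 d0.
  by move: (d * p)%N => k k0; rewrite !expnM -expnMn ltn_exp2r.
exists (blowup (@flag_point d p) (@flag_line d p) D N).
exists (fun _ => seq_fset tt (iota 0 (m * D))).
exists (blowup_labelling T); split.
- apply: blowup_max_degree.
  + by move=> u; apply: leq_trans dDN; rewrite leq_mul2r card_flag_point orbT.
  + by move=> u; apply: leq_trans dDN; rewrite leq_mul2r card_flag_line orbT.
  + by apply: leq_trans dDN; rewrite !muln_gt0 d0 D0.
- split; first exact: blowup_no_triangle.
  exact/blowup_no_quadrangle/flag_no_quadrangle.
- by move=> v; rewrite size_seq_fset undup_id ?iota_uniq // size_iota.
- apply: blowup_conflict_degree => //; first exact: flag_point_line_inj.
  exact: (Ordinal d0, Ordinal d0, 0).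
- apply: blowup_uncolourable => [v c|]; first by rewrite seq_fsetE mem_iota.
  exact: badT.
Qed.

(** * Real estimates for the number of labellings and for Delta *)

Section Analysis.
Variable R : realType.
Implicit Types alpha beta : R.

(** With M = m^2, the bound 1 - 1/M <= exp(-1/M) makes the ratio of the two sides at most M
    exp(-d/M), which is below 1 when d > M ln M = 2 m^2 ln m. *)
Lemma labelling_count_lt (m d : nat) : (1 < m)%N ->
  2 * m%:R ^+ 2 * ln m%:R < d%:R :> R ->
  (m ^ 2 * (m * m).-1 ^ d < (m * m) ^ d)%N.
Proof.
move=> m1 hd; rewrite -(ltr_nat R).
have m0 : 0 < m%:R :> R by rewrite ltr0n (ltn_trans _ m1).
have mm0 : 0 < m%:R ^+ 2 :> R by rewrite exprn_gt0.
rewrite natrM !natrX -subn1 natrB ?muln_gt0 ?(ltnW m1) // natrM -expr2.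
set M : R := m%:R ^+ 2.
have -> : M - 1 = M * (1 - M^-1) by rewrite mulrBr mulr1 mulfV ?gt_eqF.
rewrite exprMn mulrCA -[ltRHS]mulr1 ltr_pM2l ?exprn_gt0 //.
have M1 : M^-1 <= 1 by rewrite invf_le1 // exprn_ege1 // ler1n ltnW.
apply: (@le_lt_trans _ _ (M * expR (- M^-1) ^+ d)).
  rewrite ler_pM2l // lerXn2r ?nnegrE ?subr_ge0 ?expR_ge0 //.
  exact: expR_ge1Dx.
rewrite -(lnK (_ : M \in Num.pos)) ?posrE // lnK ?posrE //.
rewrite -expRM_natl -{1}(lnK (_ : M \in Num.pos)) ?posrE // -expRD expR_lt1.
rewrite /M lnXn // -/M.
rewrite mulrN subr_lt0 ltr_pdivlMr // mulrC.
by rewrite -[ln _ *+ 2]mulr_natl mulrCA mulrA.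
Qed.

(** From ln x = 2 ln (sqrt x) and ln y <= y - 1; this crude bound makes the set of candidates for
    [Delta] finite. *)
Lemma ln_le_sqrt (x : R) : 0 < x -> ln x <= 2 * Num.sqrt x.
Proof.
move=> x0; rewrite -{1}(sqr_sqrtr (ltW x0)) lnXn ?sqrtr_gt0 // -[leLHS]mulr_natl.
rewrite ler_pM2l //.
have := @le_ln1Dx R (Num.sqrt x - 1); rewrite subrKC => h.
by apply: le_trans (h _) _; [rewrite ltrBrDl subrr sqrtr_gt0|rewrite gerBl].
Qed.

(* [Delta] is the largest integer with [alpha^2 Delta <= l^2 ln Delta]. *)
Lemma exists_degree alpha (l : nat) : 1 <= alpha -> (1 < l)%N ->
  alpha ^+ 2 <= ln l%:R *+ 2 ->
  exists Delta : nat, [/\ (l ^ 2 <= Delta)%N,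
    l%:Z = Num.ceil (alpha * Num.sqrt (Delta%:R / ln Delta%:R))
    & l%:R ^+ 2 * (ln l%:R *+ 2) < alpha ^+ 2 * Delta.+1%:R].
Proof.
move=> a1 l1 al.
have l0 : 0 < l%:R :> R by rewrite ltr0n ltnW.
have a0 : 0 < alpha by lra.
pose P (n : nat) := alpha ^+ 2 * n%:R <= l%:R ^+ 2 * ln n%:R.
have Pl2 : P (l ^ 2)%N.
  by rewrite /P natrX lnXn // mulrC ler_pM2l ?exprn_gt0.
have P_bounded n : P n -> (n <= 4 * l ^ 4)%N.
  case: n => // n; rewrite /P => h; rewrite -(ler_nat R) natrM natrX.
  have n0 : 0 < n.+1%:R :> R by rewrite ltr0n.
  have sn0 : 0 < Num.sqrt (n.+1%:R : R) by rewrite sqrtr_gt0.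
  (* For N = [n.+1]: N <= alpha^2 N <= l^2 ln N <= 2 l^2 sqrt N. *)
  have s_le : Num.sqrt (n.+1%:R : R) <= 2 * l%:R ^+ 2.
    rewrite -(ler_pM2l sn0) -expr2 sqr_sqrtr ?(ltW n0) //.
    apply: (@le_trans _ _ (alpha ^+ 2 * n.+1%:R)).
      by rewrite ler_peMl ?(ltW n0) // exprn_ege1.
    apply: le_trans h _; rewrite [leRHS]mulrCA [leRHS]mulrA [leRHS]mulrC.
    by rewrite ler_pM2l ?exprn_gt0 // ln_le_sqrt.
  rewrite -(sqr_sqrtr (ltW n0)) (_ : 4 * l%:R ^+ 4 = (2 * l%:R ^+ 2) ^+ 2); last by ring.
  by rewrite lerXn2r // nnegrE ltW // (lt_le_trans sn0).
have [Delta PDelta Delta_max] := ex_maxnP (ex_intro P _ Pl2) P_bounded.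
have l2D : (l ^ 2 <= Delta)%N by apply: Delta_max.
have PS : l%:R ^+ 2 * ln Delta.+1%:R < alpha ^+ 2 * Delta.+1%:R.
  by rewrite real_ltNge ?num_real //; apply/negP => /Delta_max; rewrite ltnn.
have D0 : 0 < Delta%:R :> R by rewrite ltr0n (leq_trans _ l2D) // expn_gt0 ltnW.
have lnS : ln Delta%:R <= ln Delta.+1%:R :> R.
  by rewrite ler_ln ?ler_nat // posrE.
have lnD : ln l%:R *+ 2 <= ln Delta%:R :> R.
  by rewrite -lnXn // ler_ln ?posrE ?exprn_gt0 // -natrX ler_nat.
have lnD1 : 1 <= ln Delta%:R :> R.
  by apply: le_trans lnD; apply: le_trans al; rewrite exprn_ege1.
have lnD0 : 0 < ln Delta%:R :> R by lra.
exists Delta; split => //; last first.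
  by apply: le_lt_trans PS; rewrite ler_pM2l ?exprn_gt0 //; apply: le_trans lnS.
have q0 : 0 <= (Delta%:R / ln Delta%:R : R) by rewrite divr_ge0 ?ltW.
(* After squaring, the upper bound by l is [PDelta]; the strict lower bound by l - 1 comes from
   maximality, through [PS]. *)
apply/esym/ceil_def; apply/andP; split; last first.
  rewrite -(ler_pXn2r (_ : 0 < 2)%N) ?nnegrE ?mulr_ge0 ?sqrtr_ge0 ?(ltW a0) ?(ltW l0) //.
  by rewrite exprMn sqr_sqrtr // mulrA ler_pdivrMr.
rewrite -(ltr_pXn2r (_ : 0 < 2)%N) ?nnegrE ?mulr_ge0 ?sqrtr_ge0 ?(ltW a0) //; last first.
  by rewrite rmorphB /= subr_ge0 ler1n ltnW.
rewrite exprMn sqr_sqrtr // mulrA ltr_pdivlMr // rmorphB /=.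
have l1R : 1 <= l%:R :> R by rewrite ler1n ltnW.
rewrite -natr1 in PS.
(* Passing from Delta + 1 to Delta in [PS] costs alpha^2 <= ln Delta, a loss absorbed by l^2 - 1 >=
   (l - 1)^2. *)
have : alpha ^+ 2 <= ln Delta%:R by apply: le_trans lnD.
have : 0 <= l%:R ^+ 2 * (ln Delta.+1%:R - ln Delta%:R) :> R.
  by rewrite mulr_ge0 ?subr_ge0 // exprn_ge0 // ltW.
have : 0 <= (l%:R - 1) * ln Delta%:R :> R by rewrite mulr_ge0 ?subr_ge0 // ltW.
move: PS; rewrite natr1.
move: (ln _) (ln _) => u v.
nra.
Qed.


(** * The exponent f *)

(** Since log_{sqrt 2} alpha = 2 ln alpha / ln 2, its floor is n exactly when alpha^2 lies in [2^n,
    2^(n+1)). *)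
Lemma f_dyadic alpha (n : nat) : 1 <= alpha ->
  2 ^+ n <= alpha ^+ 2 < 2 ^+ n.+1 -> Defs.f alpha = 1 - (2 ^+ n.+1)^-1.
Proof.
move=> a1 /andP[nle ltn]; have a0 : 0 < alpha by lra.
have two0 : 0 < 2 :> R by [].
have ln2 : 0 < ln 2 :> R by rewrite ln_gt0 // ltr1n.
have lnsqrt2 : ln (Num.sqrt 2) *+ 2 = ln 2 :> R.
  by rewrite -lnXn ?sqrtr_gt0 // sqr_sqrtr.
have lns0 : 0 < ln (Num.sqrt 2) :> R by move: lnsqrt2; rewrite mulr2n; lra.
have {}nle : ln 2 *+ n <= ln alpha *+ 2.
  by rewrite -!lnXn // ler_ln ?posrE ?exprn_gt0.
have {}ltn : ln alpha *+ 2 < ln 2 *+ n.+1.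
  by rewrite -!lnXn // ltr_ln ?posrE ?exprn_gt0.
have floorE : Num.floor (logb (Num.sqrt 2) alpha) = n%:Z.
  apply/eqP; rewrite floor_eq /logb ler_pdivlMr // ltr_pdivrMr //.
  rewrite -lnsqrt2 in nle ltn; rewrite rmorphD /= -!pmulrn natr1.
  move: nle ltn; rewrite -!mulrnA ![(2 * _)%N]mulnC !mulrnA ler_pMn2r // ltr_pMn2r //.
  by rewrite !mulr_natl => -> ->.
rewrite /Defs.f floorE; congr (_ - _).
by rewrite -opprD -PoszD addn1 -exprnN.
Qed.

Lemma dyadic_bracket alpha : 1 <= alpha ->
  exists n, 2 ^+ n <= alpha ^+ 2 < 2 ^+ n.+1.
Proof.
move=> a1.
have ex0 : exists n, 2 ^+ n <= alpha ^+ 2 by exists 0%N; rewrite expr0 exprn_ege1.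
have bounded n : 2 ^+ n <= alpha ^+ 2 -> (n <= Num.bound (alpha ^+ 2))%N.
  move=> h; rewrite -(ler_nat R); apply: le_trans (ltW (archi_boundP _)); last first.
    exact: sqr_ge0.
  apply: le_trans h; rewrite -natrX ler_nat ltnW //; exact: ltn_expl.
have [n nle nmax] := ex_maxnP ex0 bounded.
exists n; rewrite nle /= real_ltNge ?num_real //; apply/negP => /nmax.
by rewrite ltnn.
Qed.

Lemma f_ge0 alpha : 1 <= alpha -> 0 <= Defs.f alpha.
Proof.
move=> a1; have [n hn] := dyadic_bracket a1; rewrite (f_dyadic a1 hn).
by rewrite subr_ge0 invf_le1 ?exprn_gt0 // exprn_ege1 // ler1n.
Qed.

Lemma f_le alpha beta : 1 <= alpha -> alpha <= beta -> Defs.f alpha <= Defs.f beta.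
Proof.
move=> a1 ab; have b1 := le_trans a1 ab.
have [n hn] := dyadic_bracket a1; have [k hk] := dyadic_bracket b1.
rewrite (f_dyadic a1 hn) (f_dyadic b1 hk) lerB // lef_pV2 ?posrE ?exprn_gt0 //.
rewrite ler_eXn2l ?ltr1n // -(ltr_eXn2l (_ : 1 < 2 :> R)) ?ltr1n //.
move: hn hk => /andP[hn _] /andP[_ hk].
apply: le_lt_trans hn (le_lt_trans _ hk).
by rewrite lerXn2r // nnegrE; lra.
Qed.

Lemma f_cvg_pinfty : Defs.f alpha @[alpha --> +oo] --> (1 : R).
Proof.
apply/cvgrPdist_lt => e e0; near=> alpha.
have a1 : 1 <= alpha by near: alpha; apply: nbhs_pinfty_ge; rewrite num_real.
have ae : e^-1 < alpha by near: alpha; apply: nbhs_pinfty_gt; rewrite num_real.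
have [n hn] := dyadic_bracket a1; rewrite (f_dyadic a1 hn).
rewrite subKr ger0_norm ?invr_ge0 ?exprn_ge0 //.
(* The chain is 1/e < alpha <= alpha^2 < 2^(n+1). *)
rewrite invf_plt ?posrE ?exprn_gt0 //.
case/andP: hn => _; apply: lt_trans; apply: lt_le_trans ae _.
by rewrite expr2 ler_peMl //; lra.
Unshelve. all: by end_near.
Qed.

(** The o(1) term is taken nonnegative: (2 sqrt 2)^2 = 8 is the left end of the bracket [8, 16),
    where f jumps from 7/8 to 15/16. *)
Lemma f_near_two_sqrt2 (eps : R ^nat) : (forall n, 0 <= eps n) ->
  eps n @[n --> \oo] --> (0 : R) ->
  \forall n \near \oo, Defs.f (2 * Num.sqrt 2 + eps n) = 15 / 16.
Proof.
move=> eps0 /cvgrPdist_lt/(_ (1 / 8)) eps_cvg; near=> n.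
have epsn : eps n < 1 / 8.
  have : `|0 - eps n| < 1 / 8 by near: n; apply: eps_cvg; lra.
  by rewrite sub0r normrN ger0_norm.
have := eps0 n; move: (eps n) epsn => x x1 x0.
have s2 : Num.sqrt 2 ^+ 2 = 2 :> R by rewrite sqr_sqrtr.
have s0 : 0 <= Num.sqrt 2 :> R by rewrite sqrtr_ge0.
move: (Num.sqrt 2) s2 s0 => s s2 s0.
have s1 : 1 <= s by nra.
have s32 : s <= 3 / 2 by nra.
rewrite (@f_dyadic _ 3); [by field|by lra|].
by apply/andP; split; [nra|nra].
Unshelve. all: by end_near.
Qed.

(** * Choice of the parameters *)

Lemma exists_large_block_number alpha (k Delta0 : nat) : 1 <= alpha ->
  alpha ^+ 2 < 2 ^+ k ->
  exists m : nat, [/\ (1 < m)%N, (Delta0 <= m)%N, alpha ^+ 2 <= ln m%:R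
    & alpha ^+ 2 <= (2 ^+ k - alpha ^+ 2) * m%:R].
Proof.
move=> a1 ak; have c0 : 0 < 2 ^+ k - alpha ^+ 2 by rewrite subr_gt0.
have q0 : 0 <= alpha ^+ 2 / (2 ^+ k - alpha ^+ 2) by rewrite divr_ge0 ?sqr_ge0 ?ltW.
have e0 := expR_gt0 (alpha ^+ 2).
have D0 : 0 <= Delta0%:R :> R by rewrite ler0n.
(* The summands secure in turn alpha^2 <= ln m, the last inequality, m >= Delta0 and m > 1. *)
set x := expR (alpha ^+ 2) + alpha ^+ 2 / (2 ^+ k - alpha ^+ 2) + Delta0%:R + 1.
have /archi_boundP : 0 <= x by rewrite /x; lra.
move: (Num.bound x) => m; rewrite /x => xm.
exists m; split.
- by rewrite -(ltr_nat R); lra.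
- by rewrite -(ler_nat R); lra.
- by rewrite -ler_expR lnK ?posrE; lra.
- by rewrite mulrC -ler_pdivrMr //; lra.
Qed.

(** Here A = alpha^2, K = 2^k, M = m and u = ln m. Multiplying the first hypothesis by M u gives (K
    - A) M^2 u >= A M u >= A, so 2 K M^2 u exceeds 2 A M^2 u by at least 2A, which covers the A lost
    in d + 1. *)
Lemma degree_arith (A u K M d : R) : A <= (K - A) * M ->
  M ^+ 2 * (K * u + K * u) < A * (d + 1) -> 1 <= u -> 1 <= A -> 1 <= M ->
  A * (2 * M ^+ 2 * u) < A * d.
Proof.
move=> am h u1 A1 M1; have A0 : 0 < A by lra.
have Mu : 1 <= M * u by rewrite mulr_ege1.
have : A * (M * u) <= (K - A) * M * (M * u) by rewrite ler_pM2r //; lra.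
have : A * 1 <= A * (M * u) by rewrite ler_pM2l.
nra.
Qed.

Lemma conflict_colouring_lower_bound alpha (k Delta0 : nat) : 1 <= alpha ->
  alpha ^+ 2 < 2 ^+ k ->
  exists Delta : nat, (Delta0 <= Delta)%N /\
  exists (G : multigraph) (l : nat) (L : vertex G -> {fset nat})
         (tau : edge_labelling G) (D : nat),
    [/\ max_degree G = Delta,
        ~ has_cycle_of_length G 3 /\ ~ has_cycle_of_length G 4,
        l%:Z = Num.ceil (alpha * Num.sqrt (Delta%:R / ln Delta%:R)) /\
          (forall v : vertex G, #|` L v|%fset = l),
        is_conflict_degree tau D /\ D%:R = l%:R `^ (1 - (2 ^+ k)^-1) :> R
      & ~ exists sigma : vertex G -> nat, proper_conflict_colouring L tau sigma].
Proof.
move=> a1 ak; have [m [m1 mD0 alnm am]] := exists_large_block_number Delta0 a1 ak.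
have m0 : (0 < m)%N by apply: ltnW.
have k0 : (0 < 2 ^ k)%N by rewrite expn_gt0.
pose D := (m ^ (2 ^ k).-1)%N; pose l := (m ^ 2 ^ k)%N.
have lE : l = (m * D)%N by rewrite /l /D -expnS prednK.
have D0 : (0 < D)%N by rewrite expn_gt0 m0.
have l_ge_m : (m <= l)%N by rewrite lE leq_pmulr.
have l1 : (1 < l)%N := leq_trans m1 l_ge_m.
have mR0 : 0 < m%:R :> R by rewrite ltr0n.
have mR1 : 1 <= m%:R :> R by rewrite ler1n.
have lnl : ln l%:R = ln m%:R *+ 2 ^ k :> R by rewrite /l natrX lnXn.
have a21 : 1 <= alpha ^+ 2 by rewrite exprn_ege1.
have lnm1 : 1 <= ln m%:R :> R by lra.
have lnl_ge : alpha ^+ 2 <= ln l%:R *+ 2.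
  have : ln m%:R <= ln l%:R :> R by rewrite ler_ln ?ler_nat // posrE ltr0n ltnW.
  by rewrite mulr2n; lra.
have [Delta [l2Delta lceil lnDelta]] := exists_degree a1 l1 lnl_ge.
exists Delta; split.
  apply: leq_trans l2Delta; apply: leq_trans mD0 (leq_trans l_ge_m _).
  by rewrite leq_pmulr // ltnW.
(* Rounding down leaves Delta + 1 <= (d + 1) D^2, the source of the term d + 1 in [degree_arith]. *)
pose d := (Delta %/ (D * D))%N.
have dDelta : (d * (D * D) <= Delta)%N by apply: leq_trunc_div.
have DeltaS : (Delta < d.+1 * (D * D))%N by rewrite ltn_ceil // muln_gt0 D0.
have d_large : 2 * m%:R ^+ 2 * ln m%:R < d%:R :> R.
  have DR0 : 0 < D%:R ^+ 2 :> R by rewrite exprn_gt0 ?ltr0n.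
  have : alpha ^+ 2 * Delta.+1%:R <= alpha ^+ 2 * ((d%:R + 1) * D%:R ^+ 2).
    rewrite ler_pM2l ?(lt_le_trans _ a21) //.
    by rewrite natr1 expr2 -!natrM ler_nat.
  move/(lt_le_trans lnDelta); rewrite lnl lE natrM exprMn.
  rewrite -[ln _ *+ 2 ^ k]mulr_natl natrX mulr2n mulrAC [ltRHS]mulrA ltr_pM2r // => h.
  have A0 : 0 < alpha ^+ 2 by lra.
  rewrite -(ltr_pM2l A0).
  exact: degree_arith am h lnm1 a21 mR1.
have d0 : (0 < d)%N.
  rewrite -(ltr_nat R); apply: le_lt_trans d_large.
  by apply: mulr_ge0; [rewrite mulr_ge0 ?exprn_ge0|lra].
have [G [L [tau [Gmax Gcycles Lcard tauD bad]]]] :=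
  exists_uncolourable_multigraph D0 d0 dDelta (labelling_count_lt m1 d_large).
exists G, l, L, tau, D; split => //; first by split=> // v; rewrite Lcard lE.
(* The exponents agree because 2^k (1 - 2^-k) = 2^k - 1. *)
split=> //; rewrite /l /D !natrX -!(@powR_mulrn _ m%:R) ?ler0n // -powRrM; congr (_ `^ _).
rewrite mulrBr mulr1 natrX mulfV ?expf_neq0 ?pnatr_eq0 //.
by rewrite -subn1 natrB // natrX.
Qed.

End Analysis.

Theorem fact1p4 (R : realType) :
  (forall alpha : R, 1 <= alpha ->
     forall Delta0 : nat, exists Delta : nat, (Delta0 <= Delta)%N /\
     exists (G : multigraph) (l : nat) (L : vertex G -> {fset nat})
            (tau : edge_labelling G) (D : nat),
       [/\ max_degree G = Delta,
           ~ has_cycle_of_length G 3 /\ ~ has_cycle_of_length G 4,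
           l%:Z = Num.ceil (alpha * Num.sqrt (Delta%:R / ln Delta%:R)) /\
             (forall v : vertex G, #|` L v|%fset = l),
           is_conflict_degree tau D /\ D%:R = l%:R `^ f alpha
         & ~ exists sigma : vertex G -> nat,
               proper_conflict_colouring L tau sigma])
  /\ (forall alpha : R, 1 <= alpha -> 0 <= f alpha)
  /\ (forall alpha beta : R, 1 <= alpha -> alpha <= beta -> f alpha <= f beta)
  /\ (f alpha @[alpha --> +oo] --> (1 : R))
  /\ (forall eps : R ^nat, (forall n, 0 <= eps n) ->
        eps n @[n --> \oo] --> (0 : R) ->
        \forall n \near \oo, f (2 * Num.sqrt 2 + eps n) = 15 / 16).
Proof.
split; last first.
  split; first exact: f_ge0.
  split; first exact: f_le.
  by split; [exact: f_cvg_pinfty|exact: f_near_two_sqrt2].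
move=> alpha a1 Delta0; have [n hn] := dyadic_bracket a1.
rewrite (f_dyadic a1 hn); case/andP: hn => _ hn.
exact: conflict_colouring_lower_bound.
Qed.
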